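(* Every good semigroup $S$ has a canonical ideal. Moreover, let $S$ be a good semigroup. For any $K\in\mathfrak{G}_S$ the following statements are equivalent: (i) $K$ is a canonical ideal of $S$. (ii) There is an $\alpha\in D_S$ such that $\alpha+K=K^0_S$. (iii) For all $E\in\mathfrak{G}_S$ we have $K-(K-E)=E$. If $K$ is a canonical ideal of $S$, then the following hold: (a) If $S\subseteq K\subseteq\overline{S}$, then $K=K^0_S$. (b) If $E\in\mathfrak{G}_S$, then $K-E\in\mathfrak{G}_S$. (c) $K-K=S$. (d) If $S'\subseteq\overline{S}$ is a good semigroup with $S\subseteq S'$, then $K'=K-S'$ is a canonical ideal of $S'$.
   Context: Conventions: $\mathbb{N}=\{0,1,2,\dots\}$. For a finite set $I$, $\mathbb{Z}^I$ carries the componentwise partial order and componentwise minimum; $\alpha<\beta$ means $\alpha\le\beta$ and $\alpha\neq\beta$. For a subset $E\subseteq\mathbb{Z}^I$ consider the properties: (E0) there is $\alpha\in\mathbb{Z}^I$ with $\alpha+\mathbb{N}^I\subseteq E$; (E1) if $\alpha,\beta\in E$, then $\min\{\alpha,\beta\}\in E$; (E2) for any $\alpha,\beta\in E$ and $j\in I$ with $\alpha_j=\beta_j$ there is $\varepsilon\in E$ with $\varepsilon_j>\alpha_j=\beta_j$ and $\varepsilon_i\ge\min\{\alpha_i,\beta_i\}$ for all $i\in I\setminus\{j\}$, with equality if $\alpha_i\neq\beta_i$. For $E,F\subseteq\mathbb{Z}^I$ put $E-F:=\{\alpha\in\mathbb{Z}^I\mid\alpha+F\subseteq E\}$. Good semigroup: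 a partially ordered cancellative commutative monoid $S$, all of whose elements are $\ge0$, whose group of differences $D_S$ is isomorphic, compatibly with the partial orders, to $\mathbb{Z}^I$ for a finite set $I$ (the isomorphism is unique up to permuting coordinates, and we identify $D_S=\mathbb{Z}^I$), and which satisfies (E0), (E1), (E2). Thus $S$ is a submonoid of $\overline{S}:=\{\alpha\in D_S\mid\alpha\ge0\}=\mathbb{N}^I$. A semigroup ideal of $S$ is a nonempty subset $E\subseteq D_S$ with $E+S\subseteq E$ and $\alpha+E\subseteq S$ for some $\alpha\in S$. It is a good semigroup ideal if it satisfies (E1) and (E2); $\mathfrak{G}_S$ is the set of good semigroup ideals of $S$. For a semigroup ideal $E$ satisfying (E1), $\mu^E:=\min E$ is its minimum, $C_E:=E-\overline{S}$, and the conductor of $E$ is $\gamma^E:=\min C_E$, so that $C_E=\gamma^E+\overline{S}$. Put $\gamma:=\gamma^S$ and $\tau:=\gamma-(1,\dots,1)$. For $\alpha\in D_S$ and $i\in I$ let $\Delta_i(\alpha):=\{\beta\in D_S\mid\beta_i=\alpha_i,\ \beta_j>\alpha_j\text{ for all }j\in I\setminus\{i\}\}$, $\Delta(\alpha):=\bigcup_{i\in I}\Delta_i(\alpha)$ and $\Delta^S(\alpha):=\Delta(\alpha)\cap S$. Define $K^0_S:=\{\alpha\in D_S\mid\Delta^S(\tau-\alpha)=\emptyset\}$. Canonical ideal of $S$: a $K\in\mathfrak{G}_S$ such that for every $E\in\mathfrak{G}_S$ with $\gamma^E=\gamma^K$, $K\subseteq E$ implies $K=E$. *)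

(* Defs.v *)
From mathcomp Require Import all_boot all_order all_algebra.
From mathcomp Require Import boolp classical_sets.

Set Implicit Arguments.
Unset Strict Implicit.
Unset Printing Implicit Defensive.

Import Order.TTheory GRing.Theory Num.Theory.
Local Open Scope ring_scope.
Local Open Scope classical_set_scope.

(* The group Z^I; addition is the pointwise one of the library's zmodType
   structure on finite functions, which carry no library order. *)
Notation "'ZZ^' I" := {ffun I -> int}
  (at level 8, I at level 2, format "'ZZ^' I") : type_scope.

Section GoodSemigroups.
Variable I : finType.
Implicit Types (a b c d e : ZZ^I) (E F K S : set ZZ^I).

Definition leZ a b : Prop := forall i, a i <= b i.

Definition minZ a b : ZZ^I := [ffun i => Num.min (a i) (b i)].

Definition oneZ : ZZ^I := [ffun=> 1].

(* The cone N^I, i.e. the semigroup written S with an overline. *)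
Definition coneZ : set ZZ^I := [set a | leZ 0 a].

Definition shift a E : set ZZ^I := [set a + b | b in E].

Definition propE0 E : Prop := exists a, shift a coneZ `<=` E.

Definition propE1 E : Prop := forall a b, E a -> E b -> E (minZ a b).

Definition propE2 E : Prop :=
  forall a b (j : I), E a -> E b -> a j = b j ->
    exists e, [/\ E e, a j < e j &
      forall i, i != j ->
        Num.min (a i) (b i) <= e i /\
        (a i <> b i -> e i = Num.min (a i) (b i))].

(* The difference E - F of subsets of Z^I (not of Minkowski type). *)
Definition subZ E F : set ZZ^I := [set a | shift a F `<=` E].

(* Good semigroups are taken under the identification of their ordered group
   of differences with Z^I: cancellativity, commutativity and the compatible
   order are then inherited from Z^I, and [gs_diff] says that the differences
   of elements of S fill Z^I. *)
Record good_semigroup S : Prop := GoodSemigroup {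
  gs_zero : S 0;
  gs_add : forall a b, S a -> S b -> S (a + b);
  gs_ge0 : S `<=` coneZ;
  gs_diff : forall d, exists a b, [/\ S a, S b & d = a - b];
  gs_E0 : propE0 S;
  gs_E1 : propE1 S;
  gs_E2 : propE2 S
}.

Record semigroup_ideal S E : Prop := SemigroupIdeal {
  si_neq0 : E !=set0;
  si_add : forall a b, E a -> S b -> E (a + b);
  si_bound : exists2 a, S a & shift a E `<=` S
}.

(* Membership of E in the set of good semigroup ideals of S. *)
Definition good_ideal S E : Prop :=
  [/\ semigroup_ideal S E, propE1 E & propE2 E].

Definition is_minimum E a : Prop := E a /\ forall b, E b -> leZ a b.

(* The minimum of E; the value is 0, without meaning, when E has none. *)
Definition minimum E : ZZ^I := xget 0 (is_minimum E).

Definition conductor E : ZZ^I := minimum (subZ E coneZ).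

Definition tau S : ZZ^I := conductor S - oneZ.

Definition Delta_at (i : I) a : set ZZ^I :=
  [set b | b i = a i /\ forall j, j != i -> a j < b j].

Definition Delta a : set ZZ^I := \bigcup_(i in [set: I]) Delta_at i a.

Definition DeltaS S a : set ZZ^I := Delta a `&` S.

Definition K0 S : set ZZ^I := [set a | DeltaS S (tau S - a) = set0].

Definition canonical_ideal S K : Prop :=
  good_ideal S K /\
  forall E, good_ideal S E -> conductor E = conductor K -> K `<=` E -> K = E.

Lemma leZ_anti a b : leZ a b -> leZ b a -> a = b.
Proof.
by move=> ab ba; apply/ffunP => i; apply/eqP; rewrite eq_le ab ba.
Qed.

Lemma minimum_eq E a : is_minimum E a -> minimum E = a.
Proof.
move=> aP; apply: xget_unique => // b [Eb bP].
by apply: leZ_anti; [exact: bP aP.1|exact: aP.2 Eb].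
Qed.

Lemma minimum_exists E b :
  E !=set0 -> propE1 E -> (forall a, E a -> leZ b a) ->
  is_minimum E (minimum E).
Proof.
move=> [a Ea] E1 bE; suff [c cP] : exists c, is_minimum E c.
  by rewrite (minimum_eq cP).
pose h c := \sum_i `|c i - b i|%N.
have [n] := ubnP (h a); elim: n a Ea => // n IHn a Ea ha.
have [?|] := pselect (forall c, E c -> leZ a c); first by exists a.
move=> /existsNP[c] /not_implyP[Ec] /existsNP[i0 /negP].
rewrite -ltNge => ca; apply: (IHn (minZ a c)); first exact: E1.
rewrite ltnS in ha; apply: leq_trans ha; rewrite /h (bigD1 i0) //= [X in (_ < X)%N](bigD1 i0) //=.
have key i : (`|minZ a c i - b i| <= `|a i - b i|)%N.
  rewrite -lez_nat !gez0_abs ?subr_ge0 ?lerD2r ?ffunE ?ge_min ?lexx //.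
    exact: bE.
  by rewrite le_min !bE.
rewrite -addSn leq_add ?leq_sum //.
rewrite -ltz_nat !gez0_abs ?subr_ge0 ?ltrD2r ?ffunE ?gt_min ?ca ?orbT //.
  exact: bE.
by rewrite le_min !bE.
Qed.

Lemma conductorP S E :
  good_semigroup S -> semigroup_ideal S E -> propE1 E ->
  is_minimum (subZ E coneZ) (conductor E).
Proof.
move=> Sg [[e Ee] ES [s Ss sE]] E1.
have subD a d : leZ 0 d -> subZ E coneZ a -> E (a + d).
  by move=> d0; apply; exists d.
apply: (minimum_exists (b := - s)).
- have [a aS] := gs_E0 Sg; exists (e + a) => _ [d d0 <-].
  by rewrite -addrA; apply: ES => //; apply: aS; exists d.
- move=> a b Ea Eb _ [d d0 <-].
  suff -> : minZ a b + d = minZ (a + d) (b + d) by apply: E1; exact: subD.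
  by apply/ffunP => i; rewrite !ffunE addr_minl.
- move=> a /(subD _ 0 (fun=> lexx _)); rewrite addr0 => Ea i.
  have /(gs_ge0 Sg)/(_ i) : S (s + a) by apply: sE; exists a.
  by rewrite !ffunE addrC -lerBlDr sub0r.
Qed.

End GoodSemigroups.

(* Main.v *)
(* For a good ideal E one has K0 - E = {a | Delta(tau - a) does not meet E}.
   Lowering coordinates of z one at a time, away from a set A of indices i for
   which Delta_i(z) misses E, leads by (E2) to a point whose whole Delta misses
   E. This yields property (E2) of K0 - E, the reflexivity K0 - (K0 - E) = E,
   and the fact that Delta(gamma^E - 1) misses E. The last one says that every
   good ideal with the conductor of S lies in K0, so canonical ideals are the
   translates of K0. If only K - (K - E) = E is known, with K contained in E and
   of the same conductor, the conductors force min (K - E) = 0; since K - E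
   satisfies (E1), 0 lies in K - E, i.e. E is contained in K. *)
Require Import Defs.
From mathcomp Require Import all_boot all_order all_algebra.
From mathcomp Require Import boolp classical_sets.
From mathcomp Require Import zify.
Import Order.TTheory GRing.Theory Num.Theory.
Local Open Scope ring_scope.
Local Open Scope classical_set_scope.

Set Implicit Arguments.
Unset Strict Implicit.
Unset Printing Implicit Defensive.

Section Duality.
Variable I : finType.
Implicit Types (a b c d e g m t x z : ZZ^I) (E F K S : set ZZ^I).

(** * Translations and differences of subsets of [Z^I] *)

Definition bounded_below E := exists m, forall e, E e -> leZ m e.

(* [ffunE] leaves coordinates at types that [lia] does not recognize as int. *)
Lemma addZE a b i : (a + b) i = a i + b i :> int. Proof. exact: ffunE. Qed.
Lemma oppZE a i : (- a) i = - a i :> int. Proof. exact: ffunE. Qed.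
Lemma zeroZE i : (0%R : ZZ^I) i = 0 :> int. Proof. exact: ffunE. Qed.
Lemma oneZE i : oneZ I i = 1. Proof. exact: ffunE. Qed.
Lemma minZE a b i : minZ a b i = Num.min (a i) (b i). Proof. exact: ffunE. Qed.
Definition coordE := (addZE, oppZE, zeroZE, oneZE, minZE, ffunE).

Lemma shiftE a E x : shift a E x <-> E (x - a).
Proof.
split; first by case=> b Eb <-; rewrite addrC addKr.
by move=> Ex; exists (x - a) => //; rewrite addrC subrK.
Qed.

Lemma shift_shift a b E : shift a (shift b E) = shift (a + b) E.
Proof.
by apply/seteqP; split=> x; rewrite !shiftE -addrA -opprD.
Qed.

Lemma shift0 E : shift 0 E = E.
Proof. by apply/seteqP; split=> x; rewrite shiftE subr0. Qed.

Lemma subZE E F x : subZ E F x <-> forall f, F f -> E (x + f).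
Proof.
by split=> [EF f Ff|EF _ [f Ff <-]]; [apply: EF; exists f|exact: EF].
Qed.

Lemma coneE a b : coneZ (b - a) <-> leZ a b.
Proof.
by split=> ab i; have := ab i; rewrite !coordE subr_ge0.
Qed.

Lemma subZ_coneE E x : subZ E (@coneZ I) x <-> forall y, leZ x y -> E y.
Proof.
rewrite subZE; split=> Ex y; last first.
  move=> y0; apply: Ex => i; rewrite !coordE.
  by have := y0 i; rewrite coordE; lia.
by move=> xy; rewrite -[y](subrK x) addrC; apply: Ex; apply/coneE.
Qed.

Lemma subZ_shift a b E F :
  subZ (shift a E) (shift b F) = shift (a - b) (subZ E F).
Proof.
apply/seteqP; split=> x; rewrite shiftE !subZE => h f.
  move=> Ff; have /h/shiftE : shift b F (f + b) by rewrite shiftE addrK.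
  by congr E; apply/ffunP => i; rewrite !coordE; lia.
rewrite !shiftE => /h.
by congr E; apply/ffunP => i; rewrite !coordE; lia.
Qed.

Lemma propE1_shift a E : propE1 E -> propE1 (shift a E).
Proof.
move=> E1 b c; rewrite !shiftE => Eb Ec; have := E1 _ _ Eb Ec.
by congr E; apply/ffunP => i; rewrite !coordE; lia.
Qed.

Lemma propE2_shift a E : propE2 E -> propE2 (shift a E).
Proof.
move=> E2 b c j; rewrite !shiftE => Eb Ec bcj.
have [|e [Ee je eP]] := E2 _ _ j Eb Ec; first by rewrite !coordE bcj.
exists (a + e); split; first by exists e.
  by move: je; rewrite !coordE; lia.
move=> i /eP; rewrite !coordE => -[h1 h2]; split; first lia.
by move=> bc; have := h2; lia.
Qed.

Lemma propE1_subZ E F : propE1 E -> propE1 (subZ E F).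
Proof.
move=> E1 a b; rewrite !subZE => Ea Eb f Ff.
have := E1 _ _ (Ea _ Ff) (Eb _ Ff).
by congr E; apply/ffunP => i; rewrite !coordE; lia.
Qed.

(** * The sets [Delta] and the lowering of points *)

Lemma Delta_shift a b c : Delta (a + c) (b + c) <-> Delta a b.
Proof.
split=> -[i _ [bi bj]]; exists i => //; split.
- by move: bi; rewrite !coordE; lia.
- by move=> j /bj; rewrite !coordE; lia.
- by rewrite !coordE bi.
- by move=> j /bj; rewrite !coordE; lia.
Qed.

(* If [Delta_at k z] meets E, lower [z k] by one: by (E2) this does not create
   elements of E in [Delta_at i z] for the other i, and as E is bounded below
   the process stops. *)
Lemma lower_to_empty_Delta E z (A : set I) :
  propE2 E -> bounded_below E ->
  (forall i b, A i -> E b -> ~ Delta_at i z b) ->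
  exists z', [/\ leZ z' z, forall i, A i -> z' i = z i &
    forall b, E b -> ~ Delta z' b].
Proof.
move=> E2 [m mE].
(* The [+ 1] keeps the summand at [k] positive even when [z k = m k], so lowering [z k] strictly
   decreases [h]. *)
pose h c := (\sum_i `|Num.max 0%R (c i - m i + 1)%R|)%N.
have [n] := ubnP (h z); elim: n z => // n IHn z hz zA.
have [zE|] := pselect (forall b, E b -> ~ Delta z b).
  by exists z; split=> // i; exact: lexx.
move=> /existsNP[b /not_implyP[Eb /contrapT [k _ zb]]].
have [bk bj] := zb.
have Ak : ~ A k by move=> Ak; exact: (zA k b).
pose z1 : ZZ^I := [ffun i => z i - (i == k)%:Z].
have z1k : z1 k = z k - 1 by rewrite coordE eqxx.
have z1j j : j != k -> z1 j = z j by rewrite coordE => /negPf ->; rewrite subr0.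
have z1z i : z1 i <= z i by rewrite coordE; lia.
have mk := mE _ Eb k.
have [||z' [z'z z'A z'E]] := IHn z1.
- rewrite ltnS in hz; apply: leq_trans hz.
  rewrite /h (bigD1 k) //= [X in (_ < X)%N](bigD1 k) //= -addSn leq_add //.
    by rewrite z1k; lia.
  by apply: leq_sum => j jk; rewrite z1j.
- move=> i c Ai Ec [ci cj].
  have ik : i != k by apply/eqP => ik; apply: Ak; rewrite -ik.
  rewrite (z1j _ ik) in ci.
  have [zck|czk] := ltP (z k) (c k).
    apply: (zA i c) => //; split=> // j ji.
    by have [->//|jk] := eqVneq j k; rewrite -(z1j _ jk) cj.
  have ki : k != i by rewrite eq_sym.
  have ck : c k = b k by have := cj _ ki; rewrite z1k; lia.
  (* Since [c i = z i < b i], (E2) at [k] keeps the value [z i] and raises coordinate [k] above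
     [z k]: [e] lies in [Delta_at i z]. *)
  have [e [Ee ke eP]] := E2 _ _ k Ec Eb ck.
  apply: (zA i e) => //; split.
    by have [_ ->] := eP _ ik; have := bj _ ik; rewrite -ci; lia.
  move=> j ji; have [->|jk] := eqVneq j k; first by rewrite -bk -ck.
  have [je _] := eP _ jk; apply: lt_le_trans je.
  by rewrite lt_min bj // -(z1j _ jk) cj.
exists z'; split=> //; first by move=> i; apply: le_trans (z'z i) (z1z i).
move=> i Ai; rewrite z'A // z1j //.
by apply/eqP => ik; apply: Ak; rewrite -ik.
Qed.

(** * Duals with respect to an arbitrary offset [t] *)

(* For [t = tau S] this is the paper's [K0 S - E], and [K0 S] when [E = S]. *)
Definition codual t E : set ZZ^I := [set a | DeltaS E (t - a) = set0].

Lemma codualE t E a : codual t E a <-> forall b, E b -> ~ Delta (t - a) b.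
Proof.
split=> [h b Eb D|h]; first by have : DeltaS E (t - a) b by []; rewrite h.
by apply/seteqP; split=> // b [D Eb]; exact: (h b).
Qed.

Lemma K0E S : K0 S = codual (tau S) S. Proof. by []. Qed.

Lemma codual_shift t t' E : codual t' E = shift (t' - t) (codual t E).
Proof.
apply/seteqP; split=> a; rewrite shiftE !codualE;
  suff -> : t - (a - (t' - t)) = t' - a by [].
all: by apply/ffunP => i; rewrite !coordE; lia.
Qed.

(** [Delta] commutes with translations, so both sides say that [Delta (t - a)] misses
    [E + S = E]. *)
Lemma codual_subZ S t E :
  S 0 -> (forall a b, E a -> S b -> E (a + b)) ->
  codual t E = subZ (codual t S) E.
Proof.
move=> S0 ES; apply/seteqP; split=> a; rewrite subZE.
  move=> /codualE aE b Eb; apply/codualE => s Ss D.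
  apply: (aE (b + s)); first exact: ES.
  rewrite [b + s]addrC; suff -> : t - a = t - (a + b) + b by apply/Delta_shift.
  by rewrite opprD addrA subrK.
move=> aE; apply/codualE => b Eb D.
have /codualE/(_ _ S0) := aE _ Eb; apply.
by apply/(Delta_shift _ _ b); rewrite opprD addrA subrK add0r.
Qed.

(** If [a i <= b i], then [t - minZ a b] dominates [t - a] with equality at [i], so its [Delta_at i]
    lies in that of [t - a]; symmetrically for [b]. *)
Lemma propE1_codual t E : propE1 (codual t E).
Proof.
move=> a b /codualE aE /codualE bE; apply/codualE => d Ed [i _ []].
rewrite !coordE => di dj.
have [ab|ba] := leP (a i) (b i); [apply: (aE _ Ed)|apply: (bE _ Ed)];
  exists i => //; rewrite /Delta_at /= !coordE; (split; first by lia);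
  by move=> j /dj; rewrite !coordE; lia.
Qed.

(** The point [t - minZ a b], lowered by one at [j], is lowered further outside the indices where
    [a] and [b] differ; subtracting the result from [t] gives the element required by (E2). *)
Lemma propE2_codual t E : propE2 E -> bounded_below E -> propE2 (codual t E).
Proof.
move=> E2 Eb a b j /codualE aE /codualE bE abj.
pose z : ZZ^I := [ffun i => t i - Num.min (a i) (b i) - (i == j)%:Z].
have [|z' [z'z z'A z'E]] :=
    @lower_to_empty_Delta E z [set i | a i <> b i] E2 Eb.
  move=> i d /= abi Ed [di dk].
  have ij : i != j by apply/eqP => ij; rewrite ij in abi.
  have dj : t j - a j <= d j.
    by have := dk j; rewrite eq_sym ij coordE eqxx -abj => /(_ isT); lia.
  have dk' k : k != i -> k != j -> t k - Num.min (a k) (b k) < d k.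
    by move=> /dk; rewrite coordE => + /negPf kj; rewrite kj; lia.
  rewrite coordE (negPf ij) in di.
  (* Here [x] is the one of [a], [b] that is smaller at [i]. If [d j > t j - a j], then [d] is in
     [Delta_at i (t - x)]; otherwise equality holds and [d] is in [Delta_at j (t - y)]. *)
  have aux (x y : ZZ^I) : x j = a j -> y j = a j -> x i < y i ->
      (forall k, Num.min (a k) (b k) = Num.min (x k) (y k)) ->
      Delta (t - x) d \/ Delta (t - y) d.
    move=> xj yj xyi abxy; rewrite abxy in di.
    have [dj'|dj'] := ltP (t j - a j) (d j).
      left; exists i => //; split; first by rewrite !coordE; lia.
      move=> k ki; rewrite !coordE; have [->|kj] := eqVneq k j.
        by rewrite xj.
      by have := dk' _ ki kj; rewrite abxy; lia.
    right; exists j => //; split; first by rewrite !coordE yj; lia.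
    move=> k kj; rewrite !coordE; have [->|ki] := eqVneq k i; first lia.
    by have := dk' _ ki kj; rewrite abxy; lia.
  have [ab|ba] : a i < b i \/ b i < a i by lia.
      by have [/aE|/bE] := aux a b erefl (esym abj) ab (fun=> erefl); apply.
  have minba k : Num.min (a k) (b k) = Num.min (b k) (a k) by rewrite minC.
  by have [/bE|/aE] := aux b a (esym abj) erefl ba minba; apply.
exists (t - z'); split.
- by apply/codualE; rewrite opprB addrC subrK.
- by have := z'z j; rewrite !coordE eqxx abj; lia.
- move=> i ij; rewrite !coordE; have := z'z i; rewrite !coordE (negPf ij).
  move=> z'i; split=> [|/z'A ->]; first lia.
  by rewrite !coordE (negPf ij); lia.
Qed.

(** If [a] is not in [E], some [i] admits no [d >= a] in [E] with [d i = a i]: otherwise [a] would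
    be a minimum of such elements. Lowering [z] then gives [z'] with [t - z'] in the dual and [a] in
    [Delta_at i z'], a contradiction. *)
Lemma codual_codual t E : E !=set0 -> propE1 E -> propE2 E -> bounded_below E ->
  codual t (codual t E) `<=` E.
Proof.
move=> [e0 Ee0] E1 E2 Eb a /codualE aE; apply: contrapT => Ea.
have [i iE] : exists i, forall d, E d -> d i = a i -> ~ leZ a d.
  apply: contrapT => /forallNP noi; apply: Ea.
  have {noi} noi i : exists d, [/\ E d, d i = a i & leZ a d].
    have /existsNP[d /not_implyP[Ed /not_implyP[di /contrapT da]]] := noi i.
    by exists d.
  have [i0|I0] := pickP (@predT I); last first.
    by suff -> : a = e0 by []; apply/ffunP => i; have := I0 i.
  move=> _; suff [d [Ed ad da]] : exists d,
      [/\ E d, leZ a d & forall i, i \in enum I -> d i = a i].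
    by suff -> : a = d by []; apply/ffunP => i; rewrite da // mem_enum.
  elim: (enum I) => [|i s [d [Ed ad da]]].
    by have [d [Ed _ ad]] := noi i0; exists d.
  have [d' [Ed' d'i ad']] := noi i; exists (minZ d d'); split.
  - exact: E1.
  - by move=> k; rewrite coordE le_min ad ad'.
  - move=> k; rewrite inE coordE => /orP[/eqP ->|ks].
      by rewrite d'i; have := ad i; lia.
    by rewrite da //; have := ad' k; lia.
pose z : ZZ^I := [ffun j => a j - (j != i)%:Z].
have [|z' [z'z z'i z'E]] := @lower_to_empty_Delta E z [set i] E2 Eb.
  move=> _ d -> Ed [di dj]; apply: (iE d) => //.
    by rewrite di coordE eqxx subr0.
  move=> j; have [->|ji] := eqVneq j i; first by rewrite di coordE eqxx subr0.
  by have := dj _ ji; rewrite coordE ji; lia.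
apply: (aE (t - z')).
  by apply/codualE; rewrite opprB addrC subrK.
exists i => //; split; first by rewrite !coordE z'i // coordE eqxx subr0.
by move=> j ji; have := z'z j; rewrite !coordE ji; lia.
Qed.

(** * Good ideals of [S], their conductors and their duals *)

Section GoodIdeals.
Variable S : set ZZ^I.
Hypothesis hS : good_semigroup S.

Lemma good_idealE E : good_ideal S E <->
  [/\ E !=set0, forall a b, E a -> S b -> E (a + b), bounded_below E,
      propE1 E & propE2 E].
Proof.
split=> [[[E0 ES [s Ss sE]] E1 E2]|[E0 ES [m mE] E1 E2]].
  split=> //; exists (- s) => e Ee i.
  have /sE/(gs_ge0 hS)/(_ i) : shift s E (s + e) by exists e.
  by rewrite !coordE; lia.
split=> //; split=> //; have [c /= cS] := gs_E0 hS.
have cS' d : leZ c d -> S d by move=> /coneE cd; apply: cS; apply/shiftE.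
(* The first entry puts this point itself in [S], the second one its sums with elements of [E]. *)
exists [ffun i => Num.max (c i) (c i - m i)].
  by apply: cS' => i; rewrite coordE; lia.
move=> _ [e Ee <-]; apply: cS' => i; rewrite !coordE.
by have := mE _ Ee i; lia.
Qed.

Lemma good_ideal_self : good_ideal S S.
Proof.
apply/good_idealE; split.
- by exists 0; exact: gs_zero.
- exact: gs_add.
- by exists 0; exact: gs_ge0.
- exact: gs_E1.
- exact: gs_E2.
Qed.

Lemma good_ideal_shift a E : good_ideal S E -> good_ideal S (shift a E).
Proof.
move=> /good_idealE[[e Ee] ES [m mE] E1 E2]; apply/good_idealE; split.
- by exists (a + e), e.
- move=> b c; rewrite !shiftE => Eb Sc.
  by rewrite addrAC; apply: ES.
- by exists (a + m) => _ [d Ed <-] i; rewrite !coordE lerD2l; exact: mE.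
- exact: propE1_shift.
- exact: propE2_shift.
Qed.

Lemma conductorE E : good_ideal S E ->
  forall c, leZ (conductor E) c <-> subZ E (@coneZ I) c.
Proof.
move=> [Ei E1 _] c; have [gE gmin] := conductorP hS Ei E1.
split=> [gc|/gmin //]; apply/subZ_coneE => y cy.
by move/subZ_coneE: gE; apply => i; apply: le_trans (gc i) (cy i).
Qed.

Lemma conductor_in E c : good_ideal S E -> leZ (conductor E) c -> E c.
Proof. by move=> Eg /(conductorE Eg)/subZ_coneE; apply. Qed.

Lemma conductor_shift a E : good_ideal S E ->
  conductor (shift a E) = a + conductor E.
Proof.
move=> Eg; have cE := conductorE Eg.
have key c : subZ (shift a E) (@coneZ I) c <-> leZ (a + conductor E) c.
  rewrite -[X in subZ _ X]shift0 subZ_shift subr0 shiftE -cE.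
  by split=> h i; have := h i; rewrite !coordE; lia.
by apply: minimum_eq; split=> [|b]; rewrite key.
Qed.

(** Given such a [b], the conductor could be lowered by one at [i], to [c]: a point [d >= c] outside
    [E] would yield [z'] below the conductor with [Delta z'] missing [E], yet containing [b]. *)
Lemma Delta_conductor E b : good_ideal S E -> E b ->
  ~ Delta (conductor E - oneZ I) b.
Proof.
move=> Eg Eb [i _ [bi bj]]; set g := conductor E in bi bj.
have [_ _ Ebd E1 E2] := (good_idealE E).1 Eg.
pose c : ZZ^I := [ffun j => g j - (j == i)%:Z].
suff /(conductorE Eg)/(_ i) : subZ E (@coneZ I) c.
  by rewrite -/g !coordE eqxx; lia.
apply/subZ_coneE => d cd; apply: contrapT => Ed.
have di : d i = g i - 1.
  apply: contrapT => di; apply: Ed; apply: (conductor_in Eg) => j.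
  by have := cd j; rewrite -/g coordE; have [->|] := eqVneq j i; lia.
pose z : ZZ^I := [ffun j => d j - (j != i)%:Z].
have [|z' [z'z z'i z'E]] := @lower_to_empty_Delta E z [set i] E2 Ebd.
  move=> _ e -> Ee [ei ej]; apply: Ed.
  (* Here [e >= d] with equality at [i], while the second point agrees with [d] wherever [d] is at
     least the conductor, that is, off [i] where needed, after taking the maximum. *)
  suff -> : d = minZ e [ffun j => Num.max (d j) (g j)].
    apply: E1 => //; apply: (conductor_in Eg) => j.
    by rewrite coordE -/g; lia.
  apply/ffunP => j; rewrite !coordE; have [->|ji] := eqVneq j i.
    by rewrite ei coordE eqxx; lia.
  have := ej _ ji; have := cd j; rewrite !coordE ji (negPf ji); lia.
have z'g j : z' j < g j.
  rewrite ltNge; apply/negP => gz.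
  (* If [z' j] reached the conductor, this point would lie in both [E] and [Delta_at j z']. *)
  apply: (z'E [ffun k => if k == j then z' k else Num.max (g k) (z' k + 1)]).
    apply: (conductor_in Eg) => k; rewrite coordE -/g.
    by have [->|_] := eqVneq k j; lia.
  exists j => //; split; first by rewrite coordE eqxx.
  by move=> k /negPf kj; rewrite coordE kj; lia.
apply: (z'E b) => //; exists i => //; split.
  by rewrite bi z'i // !coordE eqxx di; lia.
by move=> j /bj; have := z'g j; rewrite !coordE; lia.
Qed.

(** If [a i] were smaller, [t i - a i] would be at least the conductor at [i], and large other
    coordinates would give a point of [E] in [Delta_at i (t - a)]. By [Delta_conductor] the bound is
    attained. *)
Lemma codual_ge t E a : good_ideal S E -> codual t E a ->
  leZ (t - conductor E + oneZ I) a.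
Proof.
move=> Eg /codualE aE i; rewrite leNgt; apply/negP; rewrite !coordE => ai.
apply: (aE [ffun k => if k == i then t k - a k
                      else Num.max (conductor E k) (t k - a k + 1)]).
  apply: (conductor_in Eg) => k; rewrite coordE.
  by have [->|_] := eqVneq k i; lia.
exists i => //; split; first by rewrite !coordE eqxx.
by move=> k /negPf ki; rewrite !coordE ki; lia.
Qed.

Lemma good_ideal_codual t E : good_ideal S E -> good_ideal S (codual t E).
Proof.
move=> Eg; have [E0 ES Eb E1 E2] := (good_idealE E).1 Eg.
apply/good_idealE; split.
- exists (t - conductor E + oneZ I); apply/codualE => b Eb'.
  rewrite opprD opprB addrA [t + _]addrC subrK.
  exact: Delta_conductor.
- move=> a s /codualE aE Ss; apply/codualE => b Eb' D.
  apply: (aE (b + s)); first exact: ES.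
  suff -> : t - a = t - (a + s) + s by apply/Delta_shift.
  by rewrite opprD addrA subrK.
- by exists (t - conductor E + oneZ I) => a; apply: codual_ge.
- exact: propE1_codual.
- exact: propE2_codual.
Qed.

(** * Duality with respect to [K0 S] *)

Lemma subZ_K0 E : good_ideal S E -> subZ (K0 S) E = codual (tau S) E.
Proof.
move=> /good_idealE[_ ES _ _ _].
by rewrite K0E -codual_subZ //; exact: gs_zero.
Qed.

Lemma K0_good : good_ideal S (K0 S).
Proof. exact: good_ideal_codual good_ideal_self. Qed.

Lemma subZ_K0_K0 E : good_ideal S E -> subZ (K0 S) (subZ (K0 S) E) = E.
Proof.
move=> Eg; have [E0 ES Eb E1 E2] := (good_idealE E).1 Eg.
apply/seteqP; split.
  rewrite (subZ_K0 Eg) subZ_K0; first exact: codual_codual.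
  exact: good_ideal_codual.
by move=> e Ee; apply/subZE => f /subZE/(_ _ Ee); rewrite addrC.
Qed.

Lemma sub_K0 E : good_ideal S E -> conductor E = conductor S -> E `<=` K0 S.
Proof.
move=> Eg gE; suff : subZ (K0 S) E 0.
  by move=> /subZE h e /h; rewrite add0r.
rewrite subZ_K0 //; apply/codualE => b Eb.
by rewrite subr0 /tau -gE; exact: Delta_conductor.
Qed.

Lemma K0_0 : K0 S 0.
Proof.
by apply: sub_K0 => //; [exact: good_ideal_self|exact: gs_zero].
Qed.

Lemma K0_ge0 : K0 S `<=` @coneZ I.
Proof.
move=> a; rewrite K0E => /(codual_ge good_ideal_self) h i.
by have := h i; rewrite !coordE; lia.
Qed.

Lemma conductor_K0 : conductor (K0 S) = conductor S.
Proof.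
have cK := conductorE K0_good; apply: leZ_anti.
  apply/cK/subZ_coneE => y cy; apply: (sub_K0 good_ideal_self) => //.
  exact: (conductor_in good_ideal_self).
(* [codual_ge] for E = K0 S bounds the elements of K0 - K0 = S below. *)
have S0 : subZ (K0 S) (subZ (K0 S) S) 0.
  by rewrite subZ_K0_K0; [exact: gs_zero|exact: good_ideal_self].
move: S0; rewrite (subZ_K0 good_ideal_self) subZ_K0; last exact: K0_good.
move=> /(codual_ge K0_good) h i; have := h i.
by rewrite !coordE; lia.
Qed.

(** * Characterizations of canonical ideals *)

Lemma canonical_shiftP K : good_ideal S K ->
  (canonical_ideal S K <-> exists a, shift a K = K0 S).
Proof.
move=> Kg; split=> [[_ Kmax]|[a aK]].
  (* This translation gives [K] the conductor of [S], hence moves it into [K0 S]; maximality of [K]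
     applies to [K0 S] translated back. *)
  exists (conductor S - conductor K).
  set a := _ - _; have aKg := good_ideal_shift a Kg.
  have aK : shift a K `<=` K0 S.
    by apply: sub_K0 => //; rewrite conductor_shift // subrK.
  rewrite [X in shift a X](Kmax (shift (- a) (K0 S))).
  - by rewrite shift_shift subrr shift0.
  - exact: good_ideal_shift K0_good.
  - rewrite conductor_shift; last exact: K0_good.
    by rewrite conductor_K0 opprB subrK.
  - by move=> k Kk; apply/shiftE; rewrite opprK addrC; apply: aK; exists k.
split=> // E Eg gE KE; apply/seteqP; split=> // e Ee.
suff : shift a K (a + e) by rewrite shiftE addrC addKr.
rewrite aK; apply: (sub_K0 (good_ideal_shift a Eg)); last by exists e.
by rewrite conductor_shift // gE -conductor_shift // aK conductor_K0.
Qed.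

Lemma canonical_of_reflexive K : good_ideal S K ->
  (forall E, good_ideal S E -> subZ K (subZ K E) = E) -> canonical_ideal S K.
Proof.
move=> Kg Krefl; split=> // E Eg gE KE; apply/seteqP; split=> //.
have [[k Kk] KS _ K1 _] := (good_idealE K).1 Kg.
(* Adding [f] to the cone at the conductor of [E] stays in [K], so [f] cannot lower the common
   conductor. *)
have Fge0 f : subZ K E f -> leZ 0 f.
  move=> /subZE fE; suff /(conductorE Kg) h :
      subZ K (@coneZ I) (f + conductor E).
    by move=> i; have := h i; rewrite gE !coordE; lia.
  apply/subZ_coneE => y fy; rewrite -[y](subrK f) addrC; apply: fE.
  by apply: (conductor_in Eg) => i; have := fy i; rewrite !coordE; lia.
have [] := @minimum_exists I (subZ K E) 0 _ _ Fge0.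
- have [[_ _ [s Ss sE]] _ _] := Eg; exists (k + s); apply/subZE => e Ee.
  by rewrite -addrA; apply: KS => //; apply: sE; exists e.
- exact: propE1_subZ.
set m := minimum _ => mF mmin.
suff m0 : m = 0.
  by move: mF; rewrite m0 => /subZE h e /h; rewrite add0r.
apply: leZ_anti; last exact: Fge0.
(* As every [f] in [K - E] is at least [m], the cone at [conductor K - m] lies in [K - (K - E) = E];
   comparing conductors gives [m <= 0]. *)
suff /(conductorE Eg) h : subZ E (@coneZ I) (conductor K - m).
  by move=> i; have := h i; rewrite gE !coordE; lia.
apply/subZ_coneE => y my; rewrite -(Krefl _ Eg); apply/subZE => f /mmin mf.
apply: (conductor_in Kg) => i.
by have := my i; have := mf i; rewrite !coordE; lia.
Qed.

End GoodIdeals.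

(** * From [K0 S] to all canonical ideals by translation *)

Lemma subZ_shift_K0 S a K E : good_semigroup S -> good_ideal S E ->
  shift a K = K0 S -> subZ K E = shift (- a) (codual (tau S) E).
Proof.
move=> hS Eg aK; rewrite -(subZ_K0 hS Eg) -aK -{2}[E]shift0.
by rewrite subZ_shift shift_shift subr0 addNr shift0.
Qed.

End Duality.

Theorem theorem5p2p6 (I : finType) (S : set ZZ^I) (hS : good_semigroup S) :
  (exists K : set ZZ^I, canonical_ideal S K) /\
  (forall K : set ZZ^I, good_ideal S K ->
     (canonical_ideal S K <-> exists a : ZZ^I, shift a K = K0 S) /\
     ((exists a : ZZ^I, shift a K = K0 S) <->
      forall E : set ZZ^I, good_ideal S E -> subZ K (subZ K E) = E)) /\
  (forall K : set ZZ^I, canonical_ideal S K ->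
     [/\ S `<=` K -> K `<=` @coneZ I -> K = K0 S,
         forall E : set ZZ^I, good_ideal S E -> good_ideal S (subZ K E),
         subZ K K = S &
         forall S' : set ZZ^I, S' `<=` @coneZ I -> good_semigroup S' ->
           S `<=` S' -> canonical_ideal S' (subZ K S')]).
Proof.
have K0g := K0_good hS.
(* The double dual does not change when [K] is translated. *)
have refl a (K : set ZZ^I) : shift a K = K0 S ->
    forall E : set ZZ^I, good_ideal S E -> subZ K (subZ K E) = E.
  move=> aK E Eg; rewrite -{2}(subZ_K0_K0 hS Eg) -aK.
  have -> : subZ (shift a K) E = shift a (subZ K E).
    by rewrite -{1}[E]shift0 subZ_shift subr0.
  by rewrite subZ_shift subrr shift0.
split.
  by exists (K0 S); apply/(canonical_shiftP hS K0g); exists 0; exact: shift0.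
split=> [K Kg|K Kcan].
  split; first exact: canonical_shiftP.
  split=> [[a aK]|Krefl]; first exact: refl aK.
  by apply/(canonical_shiftP hS Kg)/(canonical_of_reflexive hS Kg).
have [a aK] := (canonical_shiftP hS Kcan.1).1 Kcan.
split.
(* From [0] in [K0 S] comes [- a] in [K], so [a <= 0]; from [0] in [K] comes [a] in [K0 S], so
   [a >= 0]. *)
- move=> SK K_ge0; rewrite -aK; suff -> : a = 0 by rewrite shift0.
  apply: leZ_anti.
    have : shift a K 0 by rewrite aK; exact: K0_0.
    move=> /shiftE/K_ge0 h i; have := h i; rewrite !coordE; lia.
  have : shift a K (a + 0) by exists 0 => //; apply: SK; exact: gs_zero.
  by rewrite aK addr0 => /(K0_ge0 hS).
- move=> E Eg; rewrite (subZ_shift_K0 hS Eg aK).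
  by apply: good_ideal_shift => //; exact: good_ideal_codual.
(* Thus [K - K = K - (K - S)], which is [S] by reflexivity. *)
- have KS : subZ K S = K.
    have [_ K_S _ _ _] := (good_idealE hS K).1 Kcan.1.
    apply/seteqP; split=> k.
      by move=> /subZE/(_ _ (gs_zero hS)); rewrite addr0.
    by move=> Kk; apply/subZE => s; exact: K_S.
  by rewrite -{2}KS (refl _ _ aK) //; exact: good_ideal_self.
(* As [S'] is a good ideal of [S], [K - S'] is a translate of its dual at [tau S]; replacing [tau S]
   by [tau S'] only translates again, to [K0 S']. *)
- move=> S' S'_ge0 hS' SS'.
  have S'g : good_ideal S S'.
    apply/(good_idealE hS); split.
    + by exists 0; exact: gs_zero.
    + by move=> b c S'b /SS'; exact: gs_add.
    + by exists 0.
    + exact: gs_E1.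
    + exact: gs_E2.
  rewrite (subZ_shift_K0 hS S'g aK) (codual_shift (tau S')) -K0E shift_shift.
  set b := - a + _.
  apply/(canonical_shiftP hS').
    exact: (good_ideal_shift hS' b (K0_good hS')).
  by exists (- b); rewrite shift_shift addNr shift0.
Qed.
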